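(* Let $\mathcal{A}$ be a $\sigma$-structure, $\beta$ an ordinal, and let the ultrapower hierarchy $\{\Upsilon_\alpha(\mathcal{A})\}_{\alpha\le\beta}$ be generated by $\mathcal{A}$, the index sets $\Upsilon_\alpha(\mathcal{A})$ ($\alpha<\beta$) and ultrafilters $\mathcal{U}_\alpha$ over $\Upsilon_\alpha(\mathcal{A})$. Consider the cumulative power hierarchy of $\mathcal{A}$ with index sets $I_\alpha=\mathcal{F}_\alpha(A)$. Then there is a family of ultrafilters $\{\mathcal{U}'_\alpha\}_{\alpha<\beta}$, $\mathcal{U}'_\alpha$ over $\mathcal{F}_\alpha(A)$, such that for each $\gamma\le\beta$: if for all $\delta<\gamma$ the relation $\sim_{\delta+1}$ is defined using $\mathcal{U}'_\delta$, then $\mathbb{F}_\gamma(\mathcal{A})\cong\Upsilon_\gamma(\mathcal{A})$.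
   Context: Cumulative power hierarchy with index sets $I_\alpha$: $\mathcal{F}_0(A)=A$, $\mathcal{F}_{\alpha+1}(A)=\mathcal{F}_\alpha(A)^{I_\alpha}\cup\mathcal{F}_\alpha(A)$ ($X^I$ = functions $I\to X$), $\mathcal{F}_\lambda(A)=\bigcup_{\alpha<\lambda}\mathcal{F}_\alpha(A)$ at limits (here $I_\alpha=\mathcal{F}_\alpha(A)$, which is well-defined recursively). $\rho(a)$ is the least $\alpha$ with $a\in\mathcal{F}_\alpha(A)$; $\vartheta^\alpha_j(a)=a(j)$ if $\rho(a)\ge\alpha$ and $j\in\mathrm{dom}(a)$, else $a$. For each $n$-ary function symbol $F$ and relation symbol $R$, with $\delta=\max_i\rho(a_i)$: if $\delta=0$, $F_\alpha,R_\alpha$ agree with $\mathcal{A}$; if $\delta>0$, $F_\alpha(a_1,\dots,a_n)$ is the unique $b$ with $\rho(b)=\delta$ and $b(j)=F_{\delta-1}(\vartheta^\delta_j(a_1),\dots,\vartheta^\delta_j(a_n))$ for all $j\in I_{\delta-1}$, and $R_\alpha(a_1,\dots,a_n)$ iff $R_{\delta-1}(\vartheta^\delta_j(a_1),\dots,\vartheta^\delta_j(a_n))$ for all $j\in I_{\delta-1}$. Relations $\sim$: $a\sim_0b$ iff $a=b$; with $\delta=\max(\rho(a),\rho(b))$, $a\sim_{\alpha+1}b$ iff $\{j\in I_\alpha\mid\vartheta^\delta_j(a)\sim_\alpha\vartheta^\delta_j(b)\}\in\mathcal{U}'_\alpha$ (this is ''$\sim_{\alpha+1}$ defined using $\mathcal{U}'_\alpha$'');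 $\sim_\lambda=\bigcup_{\alpha<\lambda}\sim_\alpha$ at limits. $\mathbb{F}_\alpha(\mathcal{A})$ is the $\sigma$-structure on $\mathcal{F}_\alpha(A)/\!\sim_\alpha$ with $F([x_1],\dots,[x_n])=[F_\alpha(x_1,\dots,x_n)]$, constants $c$ as $[c^{\mathcal{A}}]$, and $R([a_1],\dots,[a_n])$ iff there are $b_i\in\mathcal{F}_\alpha(A)$ with $a_i\sim_\alpha b_i$ and $R_\alpha(b_1,\dots,b_n)$. Ultrapower hierarchy: $\Upsilon_0(\mathcal{A})=\mathcal{A}$, $\Upsilon_{\alpha+1}(\mathcal{A})=\Upsilon_\alpha(\mathcal{A})^{\Upsilon_\alpha(\mathcal{A})}/\mathcal{U}_\alpha$, and for limit $\lambda$ the direct limit of $\Upsilon_\alpha(\mathcal{A})$, $\alpha<\lambda$, along $e^\alpha_\alpha=\mathrm{id}$, $e^\alpha_{\gamma+1}(x)=[\text{constant function with value }e^\alpha_\gamma(x)]_{\mathcal{U}_\gamma}$ and canonical maps at limits.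
   Formalization: The index sets $I_\alpha=\mathcal F_\alpha(A)$ are treated as pairwise disjoint, so in $\sim_{\alpha+1}$ an element of rank at most $\alpha$ counts as constant on $I_\alpha$; with the nested index sets taken literally the statement fails, e.g. for $(\omega,<)$ with $\beta=\omega+1$. *)

(* Defs.v *)
From Stdlib Require Import ClassicalEpsilon.
From mathcomp Require Import all_boot all_order.
From mathcomp Require Import boolp classical_sets filter.

Set Implicit Arguments.
Unset Strict Implicit.
Unset Printing Implicit Defensive.

Import Order.TTheory.
Local Open Scope classical_set_scope.
Local Open Scope order_scope.

(* Constant symbols are the function symbols of arity 0. *)
Record signature := Signature {
  fsym : Type;
  rsym : Type;
  farity : fsym -> nat;
  rarity : rsym -> nat }.

Record structure (s : signature) := Structure {
  carrier :> Type;
  carrier_inh : inhabited carrier;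
  fint : forall f : fsym s, ('I_(farity f) -> carrier) -> carrier;
  rint : forall r : rsym s, ('I_(rarity r) -> carrier) -> Prop }.

Definition is_iso (s : signature) (S1 S2 : structure s) (h : S1 -> S2) : Prop :=
  [/\ bijective h,
      (forall (f : fsym s) (x : 'I_(farity f) -> S1),
          h (fint x) = fint (fun i => h (x i)))
    & (forall (r : rsym s) (x : 'I_(rarity r) -> S1),
          rint x <-> rint (fun i => h (x i)))].

Definition isomorphic (s : signature) (S1 S2 : structure s) : Prop :=
  exists h : S1 -> S2, is_iso h.

Section Quotient.
Context (T : Type) (r : T -> T -> Prop).

Definition qclass (x : T) : set T := [set y | r x y].

Definition quot : Type := {c : set T | exists x, c = qclass x}.

Definition qpi (x : T) : quot := exist _ (qclass x) (ex_intro _ x erefl).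

Lemma quot_inh : inhabited T -> inhabited quot.
Proof. by case=> x; split; exact: (qpi x). Qed.

(* [G f] is the graph of the interpretation of [f] on representatives and [P]
   interprets the relation symbols on representatives; a relation holds of
   classes when it holds of some choice of representatives. *)
Definition quot_structure (s : signature) (inhT : inhabited T)
    (G : forall f : fsym s, ('I_(farity f) -> T) -> T -> Prop)
    (P : forall R : rsym s, ('I_(rarity R) -> T) -> Prop) : structure s :=
  @Structure s quot (quot_inh inhT)
    (fun f c => epsilon (quot_inh inhT) (fun d =>
       exists x y, [/\ c = (fun i => qpi (x i)), G f x y & d = qpi y]))
    (fun R c => exists x, c = (fun i => qpi (x i)) /\ P R x).

(* The quotient above is meaningful when [r] is an equivalence relation and
   every [G f] is a total function modulo [r] that is compatible with [r]. *)
Definition quot_welldef (s : signature)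
    (G : forall f : fsym s, ('I_(farity f) -> T) -> T -> Prop) : Prop :=
  [/\ (forall x, r x x),
      (forall x y, r x y -> r y x),
      (forall x y z, r x y -> r y z -> r x z),
      (forall f x, exists y, G f x y)
    & (forall f x x' y y', (forall i, r (x i) (x' i)) ->
         G f x y -> G f x' y' -> r y y')].

End Quotient.

Section Ultrapower.
Context (s : signature) (S : structure s) (I : Type) (U : set_system I).

Definition up_rel (f g : I -> S) : Prop := U [set i | f i = g i].

Lemma fun_inh : inhabited (I -> S).
Proof. by case: (carrier_inh S) => x; split; exact: (fun=> x). Qed.

Definition ultrapower : structure s :=
  @quot_structure (I -> S) up_rel s fun_inh
    (fun f x y => y = (fun i => fint (fun k => x k i)))
    (fun R x => U [set i | rint (fun k => x k i)]).

Definition up_cst (a : S) : ultrapower := qpi up_rel (fun=> a).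

End Ultrapower.

(* Direct limit of the structures [S i] along the maps [e i j], [le i j]. *)
Section DirectLimit.
Context (s : signature) (I : Type) (i0 : I) (le : I -> I -> Prop).
Context (S : I -> structure s) (e : forall i j, S i -> S j).

Let T : Type := {i : I & S i}.

Definition dl_rel (x y : T) : Prop :=
  exists k, [/\ le (projT1 x) k, le (projT1 y) k
              & e k (projT2 x) = e k (projT2 y)].

Lemma dl_inh : inhabited T.
Proof. by case: (carrier_inh (S i0)) => x; split; exact: (existT _ i0 x). Qed.

Definition dirlim : structure s :=
  @quot_structure T dl_rel s dl_inh
    (fun f x y => exists k (z : 'I_(farity f) -> S k),
       (forall i, x i = existT _ k (z i)) /\ y = existT _ k (fint z))
    (fun R x => exists k (z : 'I_(rarity R) -> S k),
       (forall i, x i = existT _ k (z i)) /\ rint z).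

Definition dl_in (i : I) (x : S i) : dirlim := qpi dl_rel (existT _ i x).

End DirectLimit.

(* Ordinals are the elements of a well-ordered type [O] with least element
   [\bot]; every ordinal occurs as an element of such a type. *)
Section Ordinals.
Context (d : Order.disp_t) (O : bOrderType d).

Definition is_succ (a b : O) : Prop := a < b /\ forall c, a < c -> b <= c.

Definition is_limit (l : O) : Prop :=
  \bot < l /\ forall a, a < l -> exists2 b, a < b & b < l.

Lemma succ_inj (b c a : O) : is_succ b a -> is_succ c a -> b = c.
Proof.
move=> [ba minb] [ca minc]; case: (ltgtP b c) => // [/minb|/minc].
  by rewrite leNgt ca.
by rewrite leNgt ba.
Qed.

End Ordinals.

Section UltrapowerHierarchy.
Context (d : Order.disp_t) (O : bOrderType d).
Context (s : signature) (A : structure s) (beta : O).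
Context (Y : O -> structure s) (U : forall a, set_system (Y a)).
Context (e : forall a b, Y a -> Y b).
Arguments U : clear implicits.
Arguments e : clear implicits.

Definition dirlim_below (l : O) (l0 : \bot < l) : structure s :=
  @dirlim s {a : O | a < l} (exist _ \bot l0)
    (fun a b => sval a <= sval b) (fun a => Y (sval a))
    (fun a b => e (sval a) (sval b)).

Definition below_in (l : O) (l0 : \bot < l) (a : O) (al : a < l) (x : Y a) :
    dirlim_below l0 :=
  @dl_in s {a : O | a < l} (exist _ \bot l0)
    (fun a b => sval a <= sval b) (fun a => Y (sval a))
    (fun a b => e (sval a) (sval b)) (exist _ a al) x.

(* [Y a], [U a] and [e a b] are only constrained for [a <= b <= beta] (and
   [a < beta] for [U]).  The recursion clauses are required up to isomorphisms
   that are compatible with the maps [e]. *)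
Definition ultrapower_hierarchy : Prop :=
  [/\ (forall a, a < beta -> UltraFilter (U a)),
      isomorphic A (Y \bot),
      (forall a x, a <= beta -> e a a x = x),
      (forall a b, is_succ a b -> b <= beta ->
         exists q : ultrapower (Y a) (U a) -> Y b, is_iso q /\
           forall c x, c <= a -> e c b x = q (up_cst (U a) (e c a x)))
    & (forall l (l0 : \bot < l), is_limit l -> l <= beta ->
         exists q : dirlim_below l0 -> Y l, is_iso q /\
           forall c (cl : c < l) x, e c l x = q (below_in l0 cl x))].

End UltrapowerHierarchy.

Section CumulativeHierarchy.
Context (d : Order.disp_t) (O : bOrderType d).
Context (wfO : well_founded (fun a b : O => a < b)).

Section Carrier.
Context (A : Type).

(* [cumF a] is F_a(A), with index sets I_c = F_c(A):
   F_a(A) = A \cup \bigcup_(c < a) F_c(A)^{F_c(A)}.  The clauses for 0,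
   successors and limits are [inF0], [inFS] and [inFL].  The elements of A are
   not functions. *)
Definition cumF : O -> Type :=
  Fix wfO (fun=> Type) (fun a rec =>
    (A + {c : O & {h : c < a & rec c h -> rec c h}})%type).

Lemma cumFE a :
  cumF a = (A + {c : O & {h : c < a & cumF c -> cumF c}})%type.
Proof.
rewrite /cumF Fix_eq //= => x f g fg; congr (_ + _)%type.
by congr sigT; apply/funext => c; congr sigT; apply/funext => h; rewrite fg.
Qed.

(* The union of all the levels: elements of A, and functions on some level. *)
Definition cum : Type := (A + {c : O & cumF c -> cumF c})%type.

Definition atom (x : A) : cum := inl x.

Definition cfun (c : O) (f : cumF c -> cumF c) : cum := inr (existT _ c f).

Definition cval (a : O) (x : cumF a) : cum :=
  match eq_rect _ id x _ (cumFE a) with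
  | inl y => atom y
  | inr (existT c (existT _ f)) => cfun f
  end.

(* The set F_a(A). *)
Definition inF (a : O) : set cum := range (@cval a).

Lemma inFE a x : inF a x <-> if x is inr (existT c _) then c < a else True.
Proof.
split=> [[y _ <-]|].
  by rewrite /cval; case: (eq_rect _ _ _ _ _) => [//|[c [h f]]].
have castK T1 T2 (E : T1 = T2 :> Type) y :
    eq_rect T1 id (eq_rect T2 id y T1 (esym E)) T2 E = y by case: T2 / E y.
case: x => [y _|[c f] h].
  by exists (eq_rect _ id (inl y) _ (esym (cumFE a))); rewrite // /cval castK.
exists (eq_rect _ id (inr (existT _ c (existT _ h f))) _ (esym (cumFE a))) => //.
by rewrite /cval castK.
Qed.

Lemma cval_inj a : injective (@cval a).
Proof.
have cast_inj T1 T2 (E : T1 = T2 :> Type) : injective (fun y => eq_rect T1 id y T2 E).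
  by case: T2 / E.
move=> x y xy; apply: (@cast_inj _ _ (cumFE a)); move: xy; rewrite /cval /=.
move: (eq_rect _ id x _ (cumFE a)) (eq_rect _ id y _ (cumFE a)) => [u|[c [h f]]] [v|[b [k g]]] //.
  by case=> ->.
rewrite /cfun => -[] bc; case: b / bc k g => k g fg.
by rewrite (existT_inj2 fg) (bool_irrelevance h k).
Qed.

Lemma inF0 : inF \bot = range atom.
Proof.
apply/seteqP; split=> [x /inFE|_ [x _ <-]]; last by apply/inFE.
by case: x => [x _|[c f]]; [exists x|rewrite ltx0].
Qed.

Lemma inFS a b : is_succ a b -> inF b = range (@cfun a) `|` inF a.
Proof.
case=> ab minb; apply/seteqP; split=> [x /inFE xb|x [[f _ <-]|/inFE xa]].
- case: x xb => [x _|[c f] cb]; first by right; apply/inFE.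
  case: (ltgtP a c) => [/minb|ca|ac]; first by rewrite leNgt cb.
  + by right; apply/inFE.
  + by left; case: c / ac f {cb} => f; exists f.
- exact/inFE.
- by apply/inFE; case: x xa => // -[c f] ca; apply: lt_trans ab.
Qed.

Lemma inFL l : is_limit l -> inF l = \bigcup_(a in [set a | a < l]) inF a.
Proof.
case=> l0 liml; apply/seteqP; split=> [x /inFE xl|x [a /= al /inFE xa]].
  case: x xl => [x _|[c f] /liml [b cb bl]]; first by exists \bot => //; apply/inFE.
  by exists b => //; apply/inFE.
by apply/inFE; case: x xa => // -[c f] ca; apply: lt_trans al.
Qed.

Definition rho (x : cum) : O :=
  xget \bot [set a | inF a x /\ forall b, inF b x -> a <= b].

Lemma rho_least a x : inF a x -> inF (rho x) x /\ forall b, inF b x -> rho x <= b.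
Proof.
move=> ax; rewrite /rho; case: xgetP => [//|none]; exfalso.
have [m [mx minm]] : exists m, inF m x /\ forall b, inF b x -> m <= b; last first.
  exact: (none m).
elim/(well_founded_ind wfO): a ax => a IH ax.
have [[b ba bx]|nob] := pselect (exists2 b, b < a & inF b x); first exact: IH bx.
by exists a; split=> // b bx; rewrite leNgt; apply/negP => ba; apply: nob; exists b.
Qed.

Lemma rho_le a x : inF a x -> rho x <= a.
Proof. by move=> ax; apply: (rho_least ax).2. Qed.

Lemma rho_atom x : rho (atom x) = \bot.
Proof. by apply/eqP; rewrite -lex0; apply/rho_le/inFE. Qed.

Lemma rho_cfun c b (f : cumF c -> cumF c) : is_succ c b -> rho (cfun f) = b.
Proof.
case=> cb minb; have fb : inF b (cfun f) by apply/inFE.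
apply: le_anti; rewrite rho_le //=; apply: minb.
by have [/inFE] := rho_least fb.
Qed.

Lemma succ_ex (a c : O) : c < a -> exists2 b, is_succ c b & b <= a.
Proof.
elim/(well_founded_ind wfO): a => a IH ca.
have [[b ba cb]|nob] := pselect (exists2 b, b < a & c < b).
  by have [b' sb' b'b] := IH b ba cb; exists b' => //; apply: le_trans (ltW ba).
exists a => //; split=> // b cb; rewrite leNgt; apply/negP => ba.
by apply: nob; exists b.
Qed.

Lemma rho_succ a x : inF a x ->
  (exists y, x = atom y) \/ exists c f, x = @cfun c f /\ is_succ c (rho x).
Proof.
case: x => [y _|[c f] /inFE ca]; first by left; exists y.
right; exists c, f; split=> //.
by have [b sb _] := succ_ex ca; rewrite -/(cfun f) (rho_cfun f sb).
Qed.

(* x(j) for j in I_c, and [None] if x is not a function on I_c.  Index sets of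
   different levels are kept disjoint: j in I_c belongs to dom(x) only if
   dom(x) = I_c.  If j in F_b(A) were also identified with its copy in F_c(A)
   for b < c, then the relation ~_(c+1) between elements of F_c(A) would depend
   on the ultrafilter over F_c(A), and would not in general extend ~_c nor be
   transitive. *)
Definition cum_app (c : O) (j : cumF c) (x : cum) : option cum :=
  if x is inr (existT b f) then
    if @eqP _ c b is ReflectT cb then Some (cval (f (eq_rect c cumF j b cb)))
    else None
  else None.

Definition theta (a c : O) (j : cumF c) (x : cum) : cum :=
  if a <= rho x then odflt x (cum_app j x) else x.

Lemma cum_app_cfun c (j : cumF c) (f : cumF c -> cumF c) :
  cum_app j (cfun f) = Some (cval (f j)).
Proof. by rewrite /cum_app /=; case: eqP => // cc; rewrite (eq_axiomK cc). Qed.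

Lemma inF_theta a c b (j : cumF c) x :
  inF b x -> rho x <= a -> is_succ c a -> inF c (theta a j x).
Proof.
move=> bx xa sca; rewrite /theta; case: ifPn => [ax|]; last first.
  rewrite -ltNge => ltxa; have [/inFE xrho _] := rho_least bx.
  apply/inFE; case: x bx xa ltxa xrho => // -[g f] _ _ ltxa /lt_le_trans; apply.
  by rewrite leNgt; apply/negP => /(sca.2); rewrite leNgt ltxa.
have {}xa : rho x = a by apply: le_anti; rewrite xa ax.
have [[y xy]|[g [f [xf]]]] := rho_succ bx; first by rewrite xy; apply/inFE.
rewrite xa => sga; have gc := succ_inj sga sca.
case: c / gc j {sca} => j; rewrite xf cum_app_cfun /=; by exists (f j).
Qed.

Section Sim.
Context (U : forall a, set_system (cumF a)).
Arguments U : clear implicits.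

Definition cum_sim : O -> cum -> cum -> Prop :=
  Fix wfO (fun=> cum -> cum -> Prop) (fun a rec x y =>
    [/\ inF a x, inF a y &
      let dl := Order.max (rho x) (rho y) in
      [\/ a = \bot /\ x = y,
          exists c (h : c < a), is_succ c a /\
            U c [set j : cumF c | rec c h (theta dl j x) (theta dl j y)]
        | is_limit a /\ exists c (h : c < a), rec c h x y]]).

Lemma cum_simE a x y : cum_sim a x y <->
  [/\ inF a x, inF a y &
    let dl := Order.max (rho x) (rho y) in
    [\/ a = \bot /\ x = y,
        exists c, is_succ c a /\
          U c [set j : cumF c | cum_sim c (theta dl j x) (theta dl j y)]
      | is_limit a /\ exists2 c, c < a & cum_sim c x y]].
Proof.
rewrite {1}/cum_sim Fix_eq /=; last first.
  move=> {}a F G FG; apply/funext => {}x; apply/funext => {}y.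
  by have -> : F = G by apply/functional_extensionality_dep => c; apply/funext.
rewrite -/cum_sim; split=> -[ax ay H]; split=> //; case: H.
- by move=> H; apply: Or31.
- by move=> [c [h H]]; apply: Or32; exists c.
- by move=> [la [c [h H]]]; apply: Or33; split=> //; exists c.
- by move=> H; apply: Or31.
- by move=> [c [sca H]]; apply: Or32; exists c, sca.1.
- by move=> [la [c h H]]; apply: Or33; split=> //; exists c, h.
Qed.

Lemma cum_sim0 x y : cum_sim \bot x y <-> inF \bot x /\ x = y.
Proof.
rewrite cum_simE; split=> [[x0 y0 [[_ xy]|[c [[]]]|[[]]]]|[x0 <-]] //.
- by rewrite ltx0.
- by rewrite ltxx.
- by split=> //; apply: Or31.
Qed.

Lemma cum_simS a b x y : is_succ a b -> cum_sim b x y <->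
  [/\ inF b x, inF b y & U a [set j : cumF a |
     cum_sim a (theta (Order.max (rho x) (rho y)) j x)
               (theta (Order.max (rho x) (rho y)) j y)]].
Proof.
move=> sab; rewrite cum_simE; split=> -[xb yb H]; split=> //; last first.
  by apply: Or32; exists a.
case: H => [[b0]|[c [scb]]|[[_ lb] _]].
- by case: sab; rewrite b0 ltx0.
- by have ca := succ_inj scb sab; case: a / ca sab.
- have [c ac cb] := lb _ sab.1.
  by have := sab.2 _ ac; rewrite leNgt cb.
Qed.

Lemma cum_simL l x y : is_limit l ->
  cum_sim l x y <-> exists2 a, a < l & cum_sim a x y.
Proof.
move=> ll; rewrite cum_simE; split=> [[_ _ [[l0 _]|[c [scl _]]|[]//]]|[a al xy]].
- by case: ll; rewrite l0 ltxx.
- have [c' cc' c'l] := ll.2 _ scl.1.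
  by have := scl.2 _ cc'; rewrite leNgt c'l.
- have inl z : inF a z -> inF l z by rewrite (inFL ll) => az; exists a.
  have [ax ay _] := (cum_simE a x y).1 xy.
  by split; [exact: inl|exact: inl|apply: Or33; split=> //; exists a].
Qed.

End Sim.
End Carrier.

Section Structure.
Context (s : signature) (A : structure s).

Definition mrho n (x : 'I_n -> cum A) : O := \big[Order.max / \bot]_i rho (x i).

Lemma mrho_ge n (x : 'I_n -> cum A) i : rho (x i) <= mrho x.
Proof. exact: (le_bigmax _ (fun i => rho (x i))). Qed.

Lemma mrho_le n (x : 'I_n -> cum A) a : (forall i, inF a (x i)) -> mrho x <= a.
Proof. by move=> xa; apply: bigmax_le => [|i _]; [exact: le0x|exact: rho_le]. Qed.

Lemma mrho_succ n (x : 'I_n -> cum A) a : (forall i, inF a (x i)) ->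
  mrho x <> \bot -> exists2 c, c < a & is_succ c (mrho x).
Proof.
move=> xa x0; have [i xi] : exists i, mrho x = rho (x i).
  apply: contrapT => no; apply: x0; apply/eqP; rewrite -lex0.
  have : forall i, rho (x i) < mrho x.
    by move=> i; rewrite lt_neqAle mrho_ge andbT; apply/eqP => e; apply: no; exists i.
  move=> lt; rewrite leNgt; apply/negP => x0.
  have : mrho x < mrho x by apply: bigmax_lt => // i _; exact: lt.
  by rewrite ltxx.
have [[y xy]|[c [f [xf sc]]]] := rho_succ (xa i).
  by case: x0; rewrite xi xy rho_atom.
exists c; last by rewrite xi.
by have /inFE := xa i; rewrite xf.
Qed.

Lemma mrho_eq0 n (x : 'I_n -> cum A) a : (forall i, inF a (x i)) ->
  mrho x = \bot -> exists y : 'I_n -> A, x = fun i => atom (y i).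
Proof.
move=> xa x0; have /choice [y xy] : forall i, exists y, x i = atom y.
  move=> i; have := mrho_ge x i; rewrite x0 lex0 => /eqP xi.
  have [//|[c [f [_ []]]]] := rho_succ (xa i).
  by rewrite xi ltx0.
by exists y; apply/funext.
Qed.

Lemma cum_inh : inhabited (cum A).
Proof. by case: (carrier_inh A) => x; split; exact: (atom x). Qed.

Lemma cumF_inh a : inhabited (cumF A a).
Proof. by rewrite cumFE; case: (carrier_inh A) => x; split; exact: (inl x). Qed.

(* F_a(x_1, ..., x_n) *)
Definition cum_fun (f : fsym s) : O -> ('I_(farity f) -> cum A) -> cum A :=
  Fix wfO (fun=> ('I_(farity f) -> cum A) -> cum A) (fun a rec x =>
    epsilon cum_inh (fun b =>
      let dl := mrho x in
      (dl = \bot /\ exists2 y : 'I_(farity f) -> A,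
         x = (fun i => atom (y i)) & b = atom (fint y))
      \/ (exists c (h : c < a), [/\ is_succ c dl, rho b = dl &
            forall j : cumF A c,
              cum_app j b = Some (rec c h (fun i => theta dl j (x i)))]))).

Lemma cum_fun_spec (f : fsym s) a (x : 'I_(farity f) -> cum A) :
  (forall i, inF a (x i)) ->
  [/\ inF a (cum_fun a x),
      (mrho x = \bot -> exists2 y : 'I_(farity f) -> A,
         x = (fun i => atom (y i)) & cum_fun a x = atom (fint y))
    & (mrho x <> \bot -> exists c, [/\ is_succ c (mrho x),
         rho (cum_fun a x) = mrho x &
         forall j : cumF A c, cum_app j (cum_fun a x) =
           Some (cum_fun c (fun i => theta (mrho x) j (x i)))])].
Proof.
elim/(well_founded_ind wfO): a x => a IH x xa.
have := erefl (cum_fun a x); rewrite {1}/cum_fun Fix_eq /=; last first.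
  move=> {}a {IH}F G FG {xa}; apply/funext => {}x.
  by have -> : F = G by apply/functional_extensionality_dep => c; apply/funext.
rewrite -/(cum_fun (f := f)); set P := fun b => _; move=> Pe.
have : P (cum_fun a x).
  rewrite -Pe; apply: epsilon_spec; rewrite /P.
  have [x0|x0] := pselect (mrho x = \bot).
    have [y xy] := mrho_eq0 xa x0.
    by exists (atom (fint y)); left; split=> //; exists y.
  have [c ca sc] := mrho_succ xa x0.
  have /choice [g gE] : forall j : cumF A c, exists y : cumF A c,
      cval y = cum_fun c (fun i => theta (mrho x) j (x i)).
    move=> j; have xi i : inF c (theta (mrho x) j (x i)).
      by apply: inF_theta (xa i) (mrho_ge x i) sc.
    by have [[y _ yE] _ _] := IH c ca _ xi; exists y.
  exists (cfun g); right; exists c, ca; split=> //; first exact: rho_cfun.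
  by move=> j; rewrite cum_app_cfun gE.
case=> [[x0 [y xy bE]]|[c [ca [sc rb bE]]]]; split.
- by rewrite bE; apply/inFE.
- by move=> _; exists y.
- by [].
- apply/inFE; case: (cumF_inh c) => j; have := bE j.
  case: (cum_fun a x) => // -[g h] /=; by case: eqP => // cg _; rewrite -cg.
- by move=> x0; case: sc; rewrite x0 ltx0.
- by move=> _; exists c.
Qed.

Lemma cum_app_ext c a (x y : cum A) : is_succ c a ->
  (exists b, inF b x) -> (exists b, inF b y) -> rho x = a -> rho y = a ->
  (forall j : cumF A c, cum_app j x = cum_app j y) -> x = y.
Proof.
have fnE z : is_succ c a -> (exists b, inF b z) -> rho z = a ->
    exists g : cumF A c -> cumF A c, z = cfun g.
  move=> sca [b bz] za; have [[u zu]|[g [f [zf sg]]]] := rho_succ bz.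
    by case: sca; rewrite -za zu rho_atom ltx0.
  rewrite za in sg; have gc := succ_inj sg sca.
  by case: c / gc sca => _; exists f.
move=> sca bx b_y xa ya; have [f ->] := fnE x sca bx xa.
have [g ->] := fnE y sca b_y ya => fg; congr cfun; apply/funext => j.
by have := fg j; rewrite !cum_app_cfun => -[/cval_inj].
Qed.

(* R_a(x_1, ..., x_n) *)
Definition cum_rel (R : rsym s) : O -> ('I_(rarity R) -> cum A) -> Prop :=
  Fix wfO (fun=> ('I_(rarity R) -> cum A) -> Prop) (fun a rec x =>
    let dl := mrho x in
    (dl = \bot /\ exists2 y : 'I_(rarity R) -> A,
       x = (fun i => atom (y i)) & rint y)
    \/ (exists c (h : c < a), is_succ c dl /\
          forall j : cumF A c, rec c h (fun i => theta dl j (x i)))).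

Lemma cum_relE (R : rsym s) a (x : 'I_(rarity R) -> cum A) :
  cum_rel a x <->
  (mrho x = \bot /\ exists2 y : 'I_(rarity R) -> A,
     x = (fun i => atom (y i)) & rint y)
  \/ (exists c, [/\ c < a, is_succ c (mrho x) &
        forall j : cumF A c, cum_rel c (fun i => theta (mrho x) j (x i))]).
Proof.
rewrite {1}/cum_rel Fix_eq /=; last first.
  move=> {}a F G FG; apply/funext => {}x.
  by have -> : F = G by apply/functional_extensionality_dep => c; apply/funext.
rewrite -/(cum_rel (R := R)); split=> -[|[c H]]; [by left| |by left|].
  by case: H => h [sc H]; right; exists c.
by case: H => h sc H; right; exists c, h.
Qed.

Section Quot.
Context (U : forall a, set_system (cumF A a)) (a : O).

Definition FF_rel (x y : cumF A a) : Prop := cum_sim U a (cval x) (cval y).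

Definition FF_graph (f : fsym s) (x : 'I_(farity f) -> cumF A a)
    (y : cumF A a) : Prop :=
  cval y = cum_fun a (fun i => cval (x i)).

(* The structure on F_a(A)/~_a. *)
Definition FF : structure s :=
  quot_structure FF_rel (cumF_inh a) FF_graph
    (fun R x => cum_rel a (fun i => cval (x i))).

Definition FF_welldef : Prop := quot_welldef FF_rel FF_graph.

End Quot.
End Structure.
End CumulativeHierarchy.

(* Main.v *)
(* One builds surjections [collapse a : F_a(A) -> Y a], compatible with the maps
   [e], such that [collapse a x = collapse a y] iff [x ~_a y] and which respect
   the operations; they then induce the isomorphisms.  Choose a section [sec c]
   of [collapse c], and let [U'_c] be the image of [U c] under [sec c].  A
   function [f] on [F_c(A)] is sent to the class modulo [U c] of
   [collapse c \o f \o sec c].  Two functions have the same image iff they are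
   pointwise [~_c]-related on a set of [U'_c], and any [g : Y c -> Y c] is hit
   by [sec c \o g \o collapse c].  At limits both sides are unions. *)
From Stdlib Require Import ClassicalEpsilon.
Require Import Defs.
From mathcomp Require Import all_boot all_order.
From mathcomp Require Import boolp classical_sets functions filter.
Import Order.TTheory.
Local Open Scope classical_set_scope.
Local Open Scope order_scope.

Set Implicit Arguments.
Unset Strict Implicit.
Unset Printing Implicit Defensive.

(** * Embeddings and quotient structures *)

Definition is_embedding (s : signature) (S1 S2 : structure s) (h : S1 -> S2) :
    Prop :=
  [/\ injective h,
      (forall (f : Defs.fsym s) (x : 'I_(farity f) -> S1),
          h (fint x) = fint (fun i => h (x i)))
    & (forall (r : rsym s) (x : 'I_(rarity r) -> S1),
          rint x <-> rint (fun i => h (x i)))].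

Section QuotientTheory.
Context (T : Type) (r : T -> T -> Prop) (s : signature) (inhT : inhabited T).
Context (G : forall f : Defs.fsym s, ('I_(farity f) -> T) -> T -> Prop).
Context (P : forall R : rsym s, ('I_(rarity R) -> T) -> Prop).

(** This does not ask for totality of the graphs, so that it also covers direct limits: there the
    graph relates only tuples lying on one common level and is partial on representatives. *)
Definition quot_compat : Prop :=
  [/\ (forall x, r x x),
      (forall x y, r x y -> r y x),
      (forall x y z, r x y -> r y z -> r x z)
    & (forall (f : Defs.fsym s) x x' y y', (forall i, r (x i) (x' i)) ->
         G (f := f) x y -> G x' y' -> r y y')].

Lemma quot_inj (c c' : quot r) : sval c = sval c' -> c = c'.
Proof.
case: c c' => [c p] [c' p'] /= cc'; case: c' / cc' p' => p'.
by congr exist; exact: Prop_irrelevance.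
Qed.

Lemma quot_surj (c : quot r) : exists x, c = qpi r x.
Proof.
by have [x cx] := svalP c; exists x; exact: quot_inj.
Qed.

Lemma quot_tuple_surj n (c : 'I_n -> quot r) :
  exists x, c = fun i => qpi r (x i).
Proof.
have /choice[x cx] : forall i, exists x, c i = qpi r x.
  by move=> i; exact: quot_surj.
by exists x; apply/funext.
Qed.

Lemma eq_qpi x y : quot_compat -> qpi r x = qpi r y <-> r x y.
Proof.
case=> rr rs rt _; split=> [[] /(congr1 (@^~ y))|xy].
  by rewrite /qclass /= => ->.
apply: quot_inj; apply/seteqP; split=> z /=; last exact: rt.
by apply: rt; exact: rs.
Qed.

(** The set from which [epsilon] chooses contains [qpi r y], and compatibility of [G] with [r] makes
    it a singleton. *)
Lemma quot_fintE (f : Defs.fsym s) (x : 'I_(farity f) -> T) y :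
  quot_compat -> G x y ->
  @fint s (quot_structure r inhT G P) f (fun i => qpi r (x i)) = qpi r y.
Proof.
move=> wd Gxy /=; set Q := (X in epsilon _ X).
have : Q (epsilon (quot_inh r inhT) Q).
  by apply: epsilon_spec; exists (qpi r y), x, y.
move=> [x' [y' [xx' Gxy' ->]]]; apply/eq_qpi => //.
have [_ _ _ Gr] := wd; apply: Gr Gxy' Gxy => i.
by apply/eq_qpi => //; have := congr1 (@^~ i) xx'.
Qed.

(** Since [r] is the kernel of [p], compatibility is inherited from the operations of [S], and [p]
    factors through the quotient as a bijection. The relation clause is existential because a
    relation on the quotient asks only for some representatives. *)
Lemma quot_isomorphic (S : structure s) (p : T -> S) :
  (forall y, exists x, p x = y) ->
  (forall x y, r x y <-> p x = p y) ->
  (forall (f : Defs.fsym s) (x : 'I_(farity f) -> T), exists y, G x y) ->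
  (forall (f : Defs.fsym s) (x : 'I_(farity f) -> T) y,
     G x y -> p y = fint (fun i => p (x i))) ->
  (forall (R : rsym s) (x : 'I_(rarity R) -> T),
     rint (fun i => p (x i)) <->
     exists x', (forall i, p (x' i) = p (x i)) /\ P x') ->
  quot_welldef r G /\ isomorphic (quot_structure r inhT G P) S.
Proof.
move=> psurj rp Gex pG pP.
have wd : quot_compat.
  split.
  - by move=> x; apply/rp.
  - by move=> x y /rp xy; apply/rp.
  - by move=> x y z /rp xy /rp yz; apply/rp; rewrite xy.
  - move=> f x x' y y' xx' /pG yE /pG y'E; apply/rp; rewrite yE y'E.
    by congr fint; apply/funext => i; exact/rp.
split; first by case: wd.
have /choice[h hE] : forall c : quot r, exists u, forall x,
    c = qpi r x -> u = p x.
  move=> c; have [x ->] := quot_surj c; exists (p x) => x'.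
  by move=> /(eq_qpi _ _ wd) /rp.
have {}hE x : h (qpi r x) = p x by exact: hE.
exists h; split.
- rewrite -setTT_bijective; split=> //.
    move=> c c' _ _; have [x ->] := quot_surj c; have [x' ->] := quot_surj c'.
    by rewrite !hE => /rp xx'; apply/(eq_qpi _ _ wd).
  by move=> y _; have [x <-] := psurj y; exists (qpi r x).
- move=> f c; have [x ->] := quot_tuple_surj c.
  have [y xy] := Gex f x; rewrite (quot_fintE wd xy) hE (pG _ _ _ xy).
  by congr fint; apply/funext => i; rewrite hE.
- move=> R c; have [x ->] := quot_tuple_surj c.
  rewrite (_ : (fun i => h _) = fun i => p (x i)); last exact/funext.
  rewrite pP /=; split=> -[x' [E Px']]; exists x'; split=> //.
    by move=> i; rewrite -!hE; congr h; rewrite (congr1 (@^~ i) E).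
  by apply/funext => i; apply/(eq_qpi _ _ wd)/rp.
Qed.

End QuotientTheory.

(** * Ultrapowers *)

Section UltrapowerTheory.
Context (s : signature) (S : structure s) (I : Type) (U : set_system I).
Context (UF : ProperFilter U).

Lemma up_compat : quot_compat (up_rel (S := S) U)
  (fun (f : Defs.fsym s) x y => y = (fun i => fint (f := f) (fun k => x k i))).
Proof.
split.
- by move=> x; apply: filterS filterT => i _.
- by move=> x y; apply: filterS => i /= ->.
- by move=> x y z; apply: filterS2 => i /= -> ->.
- move=> f x x' _ _ xx' -> ->.
  have : U [set i | forall k, x k i = x' k i] by exact: filter_forall.
  apply: filterS => i E /=.
  by congr fint; apply/funext => k; exact: E.
Qed.

(** Passing to other representatives changes finitely many functions, each only outside a set of
    [U]; truth on a set of [U] survives this. *)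
Lemma up_rintE (R : rsym s) (x : 'I_(rarity R) -> I -> S) :
  @rint s (ultrapower S U) R (fun k => qpi (up_rel U) (x k)) <->
  U [set i | rint (fun k => x k i)].
Proof.
split=> [[x' [xx']]|Ux]; last by exists x.
have {}xx' k : up_rel U (x k) (x' k).
  by apply/(eq_qpi _ _ up_compat); have := congr1 (@^~ k) xx'.
have : U [set i | forall k, x k i = x' k i] by exact: filter_forall.
apply: filterS2 => i E /=.
by rewrite (_ : x^~ i = x'^~ i) //; apply/funext.
Qed.

End UltrapowerTheory.

(** * Direct limits along embeddings *)

Section DirectLimitTheory.
Context (s : signature) (I : Type) (i0 : I) (le : I -> I -> Prop).
Context (S : I -> structure s) (e : forall i j, S i -> S j).
Arguments e : clear implicits.
Context (le_trans : forall i j k, le i j -> le j k -> le i k).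
Context (le_total : forall i j, le i j \/ le j i).
Context (e_id : forall i x, e i i x = x).
Context (e_comp : forall i j k x, le i j -> le j k ->
  e j k (e i j x) = e i k x).
Context (e_emb : forall i j, le i j -> is_embedding (e i j)).

Lemma dl_refl i : le i i. Proof. by case: (le_total i i). Qed.

(** Totality is iterated over the enumeration of ['I_n]. The extra index [j] starts the iteration,
    also when [n = 0]. *)
Lemma dl_bound n (k : 'I_n -> I) (j : I) :
  exists m, le j m /\ forall i, le (k i) m.
Proof.
have [m [jm km]] : exists m, le j m /\ forall i, i \in enum 'I_n -> le (k i) m.
  elim: (enum 'I_n) => [|i t [m [jm tm]]].
    by exists j; split=> //; exact: dl_refl.
  have [im|mi] := le_total (k i) m.
    by exists m; split=> // i'; rewrite inE => /predU1P[->//|/tm].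
  exists (k i); split=> [|i']; first exact: le_trans mi.
  rewrite inE => /predU1P[->|/tm km]; first exact: dl_refl.
  exact: le_trans mi.
by exists m; split=> // i; apply: km; rewrite mem_enum.
Qed.

(** Each equality of classes comes with its own level; a bound of these finitely many levels, taken
    above [k] and [l], serves all of them at once. *)
Lemma dl_rel_tuple n (k l : I) (x : 'I_n -> S k) (y : 'I_n -> S l) :
  (forall i, dl_rel le e (existT _ k (x i)) (existT _ l (y i))) ->
  exists m, [/\ le k m, le l m & forall i, e k m (x i) = e l m (y i)].
Proof.
move=> /choice[b xyb]; have [kl [kkl lkl]] : exists m, le k m /\ le l m.
  have [kl|lk] := le_total k l; first by exists l; split=> //; exact: dl_refl.
  by exists k; split=> //; exact: dl_refl.
have [m [klm bm]] := dl_bound b kl.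
exists m; split=> [||i]; [exact: le_trans klm|exact: le_trans klm|].
have [/= kb lb E] := xyb i.
by rewrite -(e_comp _ kb (bm i)) E e_comp.
Qed.

Lemma dl_compat : quot_compat (dl_rel le e)
  (fun (f : Defs.fsym s) x y => exists k (z : 'I_(farity f) -> S k),
       (forall i, x i = existT _ k (z i)) /\ y = existT _ k (fint z)).
Proof.
split.
- by move=> x; exists (projT1 x); split=> //; exact: dl_refl.
- by move=> x y [k [xk yk E]]; exists k.
- move=> x y z [k [xk yk xy]] [l [yl zl yz]].
  have [m [km lm]] : exists m, le k m /\ le l m.
    have [kl|lk] := le_total k l; first by exists l; split=> //; exact: dl_refl.
    by exists k; split=> //; exact: dl_refl.
  exists m; split; [exact: le_trans km|exact: le_trans lm|].
  by rewrite -(e_comp _ xk km) xy e_comp // -(e_comp _ yl lm) yz e_comp.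
- move=> f x x' _ _ xx' [k [z [xE ->]]] [k' [z' [x'E ->]]].
  have /dl_rel_tuple[m [km k'm zz']] i :
    dl_rel le e (existT _ k (z i)) (existT _ k' (z' i)) by rewrite -xE -x'E.
  exists m; split=> //=; have [_ -> _] := e_emb km; have [_ -> _] := e_emb k'm.
  by congr fint; apply/funext.
Qed.

Lemma dl_fintE k (f : Defs.fsym s) (z : 'I_(farity f) -> S k) :
  fint (fun i => dl_in i0 le e (z i)) = dl_in i0 le e (fint z).
Proof. by apply: quot_fintE; [exact: dl_compat|exists k, z]. Qed.

(** The representatives witnessing the relation may lie on another level [k']. Truth is carried from
    [k'] up to a common level [m] and reflected down to [k]. *)
Lemma dl_rintE k (R : rsym s) (z : 'I_(rarity R) -> S k) :
  rint (fun i => dl_in i0 le e (z i)) <-> rint z.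
Proof.
split=> [[x [zx [k' [z' [xE Rz']]]]]|Rz]; last first.
  by exists (fun i => existT _ k (z i)); split=> //; exists k, z.
have /dl_rel_tuple[m [km k'm zz']] i :
    dl_rel le e (existT _ k (z i)) (existT _ k' (z' i)).
  by rewrite -xE; apply/(eq_qpi _ _ dl_compat); have := congr1 (@^~ i) zx.
have [_ _ ->] := e_emb km; have [_ _ k'mR] := e_emb k'm.
by move/k'mR : Rz'; congr rint; apply/funext => i; rewrite zz'.
Qed.

Lemma eq_dl_in k (x y : S k) : dl_in i0 le e x = dl_in i0 le e y <-> x = y.
Proof.
rewrite /dl_in (eq_qpi _ _ dl_compat); split=> [[l [/= kl _]]|->].
  by have [einj _ _] := e_emb kl => /einj.
by exists k; split=> //; exact: dl_refl.
Qed.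

Lemma dl_in_e k l (x : S k) : le k l ->
  dl_in i0 le e (e k l x) = dl_in i0 le e x.
Proof.
move=> kl; apply/(eq_qpi _ _ dl_compat); exists l; split=> //=.
exact: dl_refl.
Qed.

Lemma dl_in_surj (y : dirlim i0 le e) : exists k (x : S k), y = dl_in i0 le e x.
Proof. by have [[k x] ->] := quot_surj y; exists k, x. Qed.

End DirectLimitTheory.

(** * Zero, successor and limit ordinals *)

Lemma bot_succ_limit (d : Order.disp_t) (O : bOrderType d) (g : O) :
  [\/ g = \bot, exists c, is_succ c g | is_limit g].
Proof.
have [->|g0] := eqVneq g \bot; first exact: Or31.
have [[c sc]|nosucc] := pselect (exists c, is_succ c g).
  by apply: Or32; exists c.
apply: Or33; split=> [|a ag]; first by rewrite lt0x.
apply: contrapT => nob; apply: nosucc; exists a; split=> // c ac.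
by rewrite leNgt; apply/negP => cg; apply: nob; exists c.
Qed.

Lemma succ_le (d : Order.disp_t) (O : bOrderType d) (c b a : O) :
  is_succ c b -> a <= b -> a = b \/ a <= c.
Proof.
move=> [cb minb]; rewrite le_eqVlt => /predU1P[|ab]; first by left.
by right; rewrite leNgt; apply/negP => /minb; rewrite leNgt ab.
Qed.

(** * Embeddings and projections in the ultrapower hierarchy *)

Section UltrapowerHierarchyTheory.
Context (d : Order.disp_t) (O : bOrderType d).
Context (wfO : well_founded (fun a b : O => a < b)).
Context (s : signature) (A : structure s) (beta : O).
Context (Y : O -> structure s) (U : forall a, set_system (Y a)).
Context (e : forall a b, Y a -> Y b).
Arguments U : clear implicits.
Arguments e : clear implicits.
Context (HY : ultrapower_hierarchy A beta U e).

(** [Q] stands for the map taking a function to its class modulo [U a], read in [Y b]. With these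
    clauses later arguments compute with functions and never reopen the quotient. *)
Definition ultrapower_proj (a b : O) (Q : (Y a -> Y a) -> Y b) : Prop :=
  [/\ (forall y, exists f, Q f = y),
      (forall f g, Q f = Q g <-> U a [set j | f j = g j]),
      (forall (F : Defs.fsym s) (x : 'I_(farity F) -> Y a -> Y a),
         Q (fun j => fint (fun k => x k j)) = fint (fun k => Q (x k))),
      (forall (R : rsym s) (x : 'I_(rarity R) -> Y a -> Y a),
         rint (fun k => Q (x k)) <-> U a [set j | rint (fun k => x k j)])
    & (forall c x, c <= a -> e c b x = Q (fun=> e c a x))].

Lemma hierarchy_ultra a : a < beta -> UltraFilter (U a).
Proof. by case: HY => + _ _ _ _; exact. Qed.

Lemma hierarchy_id a x : a <= beta -> e a a x = x.
Proof. by case: HY => _ _ + _ _; exact. Qed.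

Lemma ultrapower_proj_ex a b : is_succ a b -> b <= beta ->
  exists Q, @ultrapower_proj a b Q.
Proof.
move=> sab bbeta; have [_ _ _ /(_ _ _ sab bbeta)[q [[qbij qF qR] qe]] _] := HY.
have [ab _] := sab.
have UF : ProperFilter (U a).
  by apply: ultra_proper; apply: hierarchy_ultra; exact: lt_le_trans bbeta.
exists (fun f => q (qpi (up_rel (U a)) f)); split=> //.
- have [q' qK q'K] := qbij; move=> y; have [f E] := quot_surj (q' y).
  by exists f; rewrite -E q'K.
- move=> f g; rewrite -[U a _]/(up_rel (U a) f g).
  rewrite -(eq_qpi _ _ (up_compat _ UF)).
  by split=> [/(bij_inj qbij)|->].
- move=> F x; rewrite -qF; congr q; apply/esym.
  exact: (quot_fintE _ _ (up_compat _ UF)).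
- by move=> R x; rewrite -qR up_rintE.
Qed.

(** The two properties go through one induction on [b]: at a limit, the facts on direct limits
    require both of them at all lower levels. *)
Lemma hierarchy_emb_comp b : b <= beta -> forall a, a <= b ->
  is_embedding (e a b) /\ forall c x, c <= a -> e a b (e c a x) = e c b x.
Proof.
elim/(well_founded_ind wfO): b => b IH bbeta.
(* The successor and limit clauses of the hierarchy describe [e a b] only for [a < b], so [a = b] is
   settled first. *)
have diag : is_embedding (e b b) /\
    forall c x, c <= b -> e b b (e c b x) = e c b x.
  have eid x : e b b x = x by exact: hierarchy_id.
  split=> [|c x cb]; last exact: eid.
  split=> [x y|f x|R x].
  - by rewrite !eid.
  - by rewrite eid; congr fint; apply/funext => i; rewrite eid.
  - by rewrite (_ : (fun i => _) = x) //; apply/funext => i; rewrite eid.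
case: (bot_succ_limit b) => [b0|[c scb]|limb] a ab.
- by move: ab; rewrite b0 lex0 => /eqP ->; rewrite -b0.
- have [->//|ac] := succ_le scb ab.
  have [cb _] := scb.
  have [[einj eF eR] ecomp] := IH c cb (le_trans (ltW cb) bbeta) a ac.
  have [Q [Qsurj Qinj QF QR Qe]] := ultrapower_proj_ex scb bbeta.
  have UF : ProperFilter (U c).
    by apply: ultra_proper; apply: hierarchy_ultra; exact: lt_le_trans bbeta.
  split=> [|c' x c'a]; last first.
    by rewrite !Qe ?(le_trans c'a)// ecomp.
  split=> [x y|f x|R x].
  (* The images are classes of constant functions, which agree everywhere once they agree at one
     point; a member of a proper filter supplies that point. The relation clause uses the same
     argument. *)
  + by rewrite !Qe// => /Qinj/filter_ex[_ /=] /einj.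
  + rewrite Qe// eF QF; congr fint.
    by apply/funext => k; rewrite Qe.
  + rewrite (_ : (fun i => _) = fun i => Q (fun=> e a c (x i))); last first.
      by apply/funext => k; rewrite Qe.
    rewrite QR eR; split=> [Rx|/filter_ex[]//].
    by apply: filterS filterT => j _.
- have [->|a_b] := eqVneq a b; first exact: diag.
  have {a_b} altb : a < b by rewrite lt_neqAle a_b.
  have [b0 _] := limb.
  have [_ _ _ _ /(_ _ b0 limb bbeta)[q [[qbij qF qR] qe]]] := HY.
  (* The data are restricted to the ordinals below [b]; the hypotheses on direct limits then come
     from the induction hypothesis. *)
  pose I := {a : O | a < b}; pose leI (i j : I) := sval i <= sval j.
  have leI_trans i j k : leI i j -> leI j k -> leI i k by exact: le_trans.
  have leI_total i j : leI i j \/ leI j i by apply/orP; exact: le_total.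
  pose eI (i j : I) := e (sval i) (sval j).
  have leIbeta (i : I) : sval i <= beta.
    exact: le_trans (ltW (svalP i)) bbeta.
  have eI_id i x : eI i i x = x by exact: hierarchy_id.
  have eI_comp i j k x : leI i j -> leI j k -> eI j k (eI i j x) = eI i k x.
    by move=> ij jk; have [_ +] := IH _ (svalP k) (leIbeta k) _ jk; exact.
  have eI_emb i j : leI i j -> is_embedding (eI i j).
    by move=> ij; have [] := IH _ (svalP j) (leIbeta j) _ ij.
  split=> [|c x ca].
    split=> [x y|f x|R x].
    + rewrite !(qe _ altb) => /(bij_inj qbij).
      by rewrite /below_in eq_dl_in.
    + rewrite (qe _ altb) (_ : (fun i => e a b (x i)) =
        fun i => q (below_in e b0 altb (x i))); last by apply/funext => i.
      by rewrite -qF dl_fintE.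
    + rewrite (_ : (fun i => e a b (x i)) =
        fun i => q (below_in e b0 altb (x i))); last by apply/funext => i.
      by rewrite -qR dl_rintE.
  rewrite (qe _ altb) (qe _ (le_lt_trans ca altb)); congr q.
  exact: (@dl_in_e _ _ _ leI _ eI _ _ _ _ _
    (exist _ c (le_lt_trans ca altb)) (exist _ a altb)).
Qed.

Lemma hierarchy_emb a b : a <= b -> b <= beta -> is_embedding (e a b).
Proof. by move=> ab bbeta; case: (hierarchy_emb_comp bbeta ab). Qed.

Lemma hierarchy_comp a b c x : a <= b -> b <= c -> c <= beta ->
  e b c (e a b x) = e a c x.
Proof. by move=> ab bc cb; have [_ ->] := hierarchy_emb_comp cb bc. Qed.

Lemma hierarchy_limit_surj l (y : Y l) : is_limit l -> l <= beta ->
  exists a (x : Y a), a < l /\ e a l x = y.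
Proof.
move=> liml lbeta; have [l0 _] := liml.
have [_ _ _ _ /(_ _ l0 liml lbeta)[q [[[q' qK q'K] _ _] qe]]] := HY.
have [[a al] [x E]] := dl_in_surj (q' y).
by exists a, x; split=> //; rewrite (qe _ al) -[RHS]q'K E.
Qed.

End UltrapowerHierarchyTheory.

(** * Coordinates and change of level in the cumulative hierarchy *)

Section CumulativeHierarchyTheory.
Context (d : Order.disp_t) (O : bOrderType d).
Context (wfO : well_founded (fun a b : O => a < b)).

Section Elements.
Context (A : Type).
Implicit Types x y : cum wfO A.

Lemma inF_le a b x : a <= b -> inF a x -> inF b x.
Proof.
move=> ab /inFE xa; apply/inFE; case: x xa => // -[c f] ca.
exact: lt_le_trans ab.
Qed.

Lemma inF_rho a b x : inF b x -> rho x <= a -> inF a x.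
Proof. by move=> /rho_least[xx _] xa; exact: inF_le xx. Qed.

(** An element of F_c is an atom or a function on a strictly earlier level, so its domain is never
    [cumF c]. *)
Lemma cum_app_inF c (j : cumF wfO A c) x : inF c x -> cum_app j x = None.
Proof.
move=> /inFE; case: x => // -[b f] bc /=; case: eqP => // cb.
by have : b < b by [rewrite -{2}cb]; rewrite ltxx.
Qed.

(* [theta] without its rank test; an [x] which is not a function on [cumF c]
   counts as a constant function. *)
Definition coord c (j : cumF wfO A c) x : cum wfO A := odflt x (cum_app j x).

Lemma coord_inF c (j : cumF wfO A c) x : inF c x -> coord j x = x.
Proof. by move=> xc; rewrite /coord cum_app_inF. Qed.

Lemma coord_cfun c (j : cumF wfO A c) f : coord j (cfun f) = cval (f j).
Proof. by rewrite /coord cum_app_cfun. Qed.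

Lemma inF_cval c (j : cumF wfO A c) : inF c (cval j).
Proof. by exists j. Qed.

Lemma inF_succ c b x : is_succ c b -> inF b x ->
  (exists f : cumF wfO A c -> cumF wfO A c, x = cfun f) \/ inF c x.
Proof.
by move=> scb; rewrite (inFS _ _ scb) => -[[f _ <-]|]; [left; exists f|right].
Qed.

Lemma inF_coord c b (j : cumF wfO A c) x :
  is_succ c b -> inF b x -> inF c (coord j x).
Proof.
move=> scb /(inF_succ scb)[[f ->]|xc]; last by rewrite coord_inF.
by rewrite coord_cfun; exact: inF_cval.
Qed.

(** The rank test can fail only on elements of F_c, which [coord] leaves fixed: a function on
    [cumF c] has rank [b], at least [dl]. *)
Lemma theta_coord c b dl (j : cumF wfO A c) x :
  is_succ c b -> inF b x -> dl <= b -> theta dl j x = coord j x.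
Proof.
move=> scb xb dlb; rewrite /theta; case: ifPn => //.
have [[f xE]|xc _] := inF_succ scb xb; last by rewrite coord_inF.
by rewrite xE (rho_cfun f scb) dlb.
Qed.

End Elements.

Section Structure.
Context (s : signature) (A : structure s).

Lemma inF_mrho n (x : 'I_n -> cum wfO A) a b :
  (forall i, inF b (x i)) -> mrho x <= a -> forall i, inF a (x i).
Proof.
move=> xb xa i; apply: inF_rho (xb i) _; exact: le_trans (mrho_ge x i) xa.
Qed.

(** The level only bounds the recursion: by [cum_fun_spec], the rank of the tuple fixes which clause
    applies and at which smaller level the coordinates are computed. *)
Lemma cum_fun_le (f : Defs.fsym s) a b (x : 'I_(farity f) -> cum wfO A) :
  a <= b -> (forall i, inF a (x i)) -> cum_fun b x = cum_fun a x.
Proof.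
move=> ab xa; have xb i : inF b (x i) by exact: inF_le (xa i).
have [xFa xa0 xaS] := cum_fun_spec xa; have [xFb xb0 xbS] := cum_fun_spec xb.
have [x0|x0] := pselect (mrho x = \bot).
  have [y xy ->] := xa0 x0; have [y' xy' ->] := xb0 x0.
  congr (atom _ (fint _)); apply/funext => i.
  by have := congr1 (@^~ i) xy'; rewrite xy => -[].
have [c [sc xca appa]] := xaS x0; have [c' [sc' xcb appb]] := xbS x0.
have cc' := succ_inj sc sc'; case: c' / cc' sc' appb => _ appb.
apply: (cum_app_ext sc) => //; [by exists b|by exists a|].
by move=> j; rewrite appa appb.
Qed.

(** Again the rank of the tuple dictates the clause, and its predecessor lies below every level
    containing the tuple. *)
Lemma cum_rel_le (R : rsym s) a b (x : 'I_(rarity R) -> cum wfO A) :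
  a <= b -> (forall i, inF a (x i)) -> cum_rel b x <-> cum_rel a x.
Proof.
move=> ab xa; rewrite !cum_relE.
split=> -[|[c [cb sc xc]]]; [by left| |by left|].
  right; exists c; split=> //; have [cx _] := sc.
  exact: lt_le_trans cx (mrho_le xa).
by right; exists c; split=> //; exact: lt_le_trans ab.
Qed.

End Structure.
End CumulativeHierarchyTheory.

(** * The collapse onto the ultrapower hierarchy and the ultrafilters it induces *)

Section Collapse.
Context (d : Order.disp_t) (O : bOrderType d).
Context (wfO : well_founded (fun a b : O => a < b)).
Context (s : signature) (A : structure s) (beta : O).
Context (Y : O -> structure s) (U : forall a, set_system (Y a)).
Context (e : forall a b, Y a -> Y b).
Arguments U : clear implicits.
Arguments e : clear implicits.
Context (HY : ultrapower_hierarchy A beta U e).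
Context (i0 : A -> Y \bot) (i0_iso : is_iso i0).

Lemma uproj_inh a b : inhabited ((Y a -> Y a) -> Y b).
Proof. by case: (carrier_inh (Y b)) => y; split=> _. Qed.

(** Choosing by [epsilon] gives a function for all [a] and [b], usable inside the recursion below;
    it is meaningful when [b] is the successor of [a] and [b <= beta]. *)
Definition uproj a b : (Y a -> Y a) -> Y b :=
  epsilon (uproj_inh a b) (@ultrapower_proj _ _ _ _ U e a b).

Lemma uprojP a b : is_succ a b -> b <= beta ->
  ultrapower_proj U e (@uproj a b).
Proof.
by move=> sab bbeta; apply: epsilon_spec; exact: (ultrapower_proj_ex HY).
Qed.

(* Junk when [c] is the greatest element of [O]. *)
Definition next (c : O) : O := epsilon (inhabits \bot) (is_succ c).

Lemma next_succ c b : is_succ c b -> next c = b.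
Proof.
move=> scb; have [cb minb] := scb.
have [cn minn] : is_succ c (next c) by apply: epsilon_spec; exists b.
by apply: le_anti; rewrite minb // minn.
Qed.

(** The map [p] is a parameter because the recursion defining [collapse] applies this to its own
    recursive call. *)
Definition section_of c (p : cum wfO A -> Y c) (y : Y c) : cumF wfO A c :=
  epsilon (cumF_inh wfO A c) (fun j => p (cval j) = y).

(* An atom is sent to its image in [Y a]; a function [f] on [cumF c] is
   transported to [Y c -> Y c] along the collapse of [cumF c] and a section of
   it, and its class in [Y c.+1] is then embedded in [Y a].  Off [inF a] the
   value is junk. *)
Definition collapse : forall a, cum wfO A -> Y a :=
  Fix wfO (fun a => cum wfO A -> Y a) (fun a rec x =>
    match x with
    | inl y => e \bot a (i0 y)
    | inr (existT c f) =>
      match pselect (c < a) with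
      | left h => e (next c) a (@uproj c (next c)
          (fun y => rec c h (cval (f (section_of (rec c h) y)))))
      | right _ => epsilon (carrier_inh (Y a)) (fun=> True)
      end
    end).

Definition sec c : Y c -> cumF wfO A c := section_of (collapse c).
Arguments sec : clear implicits.

Lemma collapseE a x : collapse a x =
    match x with
    | inl y => e \bot a (i0 y)
    | inr (existT c f) =>
      match pselect (c < a) with
      | left h => e (next c) a (@uproj c (next c)
          (fun y => collapse c (cval (f (sec c y)))))
      | right _ => epsilon (carrier_inh (Y a)) (fun=> True)
      end
    end.
Proof.
rewrite {1}/collapse Fix_eq // => {}a F G FG.
by have -> : F = G by apply/functional_extensionality_dep => c; apply/funext.
Qed.

Lemma collapse_atom a y : collapse a (atom wfO y) = e \bot a (i0 y).
Proof. by rewrite collapseE. Qed.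

Lemma collapse_cfun a b c (f : cumF wfO A c -> cumF wfO A c) :
  is_succ c b -> b <= a ->
  collapse a (cfun f) =
  e b a (@uproj c b (fun y => collapse c (cval (f (sec c y))))).
Proof.
move=> scb ba; rewrite collapseE /= (next_succ scb); case: pselect => // -[].
by have [cb _] := scb; exact: lt_le_trans ba.
Qed.

(** Both values are images of one element, lying in [Y \bot] for an atom and in the level right
    after the domain for a function, so the maps [e] just compose. *)
Lemma collapse_le a b x : inF a x -> a <= b -> b <= beta ->
  collapse b x = e a b (collapse a x).
Proof.
move=> /inFE xa ab bbeta; case: x xa => [y _|[c f] ca].
  by rewrite !collapse_atom (hierarchy_comp wfO HY).
have [c' scc' c'a] := succ_ex wfO ca.
rewrite (collapse_cfun f scc' c'a) (collapse_cfun f scc' (le_trans c'a ab)).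
by rewrite (hierarchy_comp wfO HY).
Qed.

(** One formula covers both kinds of elements of F_b: an element of F_c counts as a constant
    function, in agreement with the last clause of [ultrapower_proj]. *)
Lemma collapse_succ c b x : is_succ c b -> b <= beta -> inF b x ->
  collapse b x = @uproj c b (fun y => collapse c (coord (sec c y) x)).
Proof.
move=> scb bbeta /(inF_succ scb)[[f ->]|xc].
  rewrite (collapse_cfun f scb (lexx b)) (hierarchy_id HY) //.
  by congr uproj; apply/funext => y; rewrite coord_cfun.
have [cb _] := scb; rewrite (collapse_le xc (ltW cb) bbeta).
have [_ _ _ _ Qe] := uprojP scb bbeta; rewrite Qe //; congr uproj.
apply/funext => y; rewrite coord_inF// (hierarchy_id HY)//.
exact: le_trans (ltW cb) bbeta.
Qed.

(** There is no circularity: [collapse] and [sec] are built from the ultrapower hierarchy and never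
    mention ~, so these filters are available before ~ is. *)
Definition cum_ultra (c : O) : set_system (cumF wfO A c) :=
  [set X | U c [set y | X (sec c y)]].
Arguments cum_ultra : clear implicits.

Lemma cum_ultraP c : c < beta -> UltraFilter (cum_ultra c).
Proof.
move=> cbeta; have UU := hierarchy_ultra HY cbeta.
have PF : ProperFilter (cum_ultra c).
  split; first by move=> /filter_ex[].
  split; first exact: filterT.
    by move=> P Q; exact: filterI.
  by move=> P Q PQ; apply: filterS => y; exact: PQ.
split=> // G PG sub; apply/seteqP; split=> // X GX.
(* Maximality: if [X] were not in the image filter, its complement would be, and [G] would contain
   two disjoint sets. *)
have [//|UnX] := in_ultra_setVsetC [set y | X (sec c y)] UU.
have GnX : G (~` X) by exact: sub.
by have [j []] := filter_ex (filterI GX GnX).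
Qed.

(** * Induction on the levels *)

Definition collapse_good (g : O) : Prop :=
  [/\ (forall x y, inF g x -> inF g y ->
         cum_sim cum_ultra g x y <-> collapse g x = collapse g y),
      (forall y, exists2 x, inF g x & collapse g x = y),
      (forall (f : Defs.fsym s) (x : 'I_(farity f) -> cum wfO A),
         (forall i, inF g (x i)) ->
         collapse g (cum_fun g x) = fint (fun i => collapse g (x i)))
    & (forall (R : rsym s) (x : 'I_(rarity R) -> cum wfO A),
         (forall i, inF g (x i)) ->
         rint (fun i => collapse g (x i)) <->
         exists x', [/\ (forall i, inF g (x' i)),
           (forall i, collapse g (x' i) = collapse g (x i)) & cum_rel g x'])].

Lemma collapse_sec c y : collapse_good c -> collapse c (cval (sec c y)) = y.
Proof.
case=> _ /(_ y)[_ [j _ <-] jy] _ _.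
by apply: (epsilon_spec _ (fun j => collapse c (cval j) = y)); exists j.
Qed.

(** Without changing representatives only this direction is available: [cum_rel] demands the
    relation at every index, not on a large set, and is in general not invariant under ~. Hence the
    existential in [collapse_good]. *)
Lemma collapse_good_rel g (R : rsym s) (x : 'I_(rarity R) -> cum wfO A) :
  collapse_good g -> (forall i, inF g (x i)) -> cum_rel g x ->
  rint (fun i => collapse g (x i)).
Proof. by case=> _ _ _ gR xg Rx; apply/gR => //; exists x. Qed.

Lemma collapse_good_bot : collapse_good \bot.
Proof.
have atoms n (x : 'I_n -> cum wfO A) : (forall i, inF \bot (x i)) ->
    mrho x = \bot /\ exists y, x = fun i => atom wfO (y i).
  move=> x0; have x00 : mrho x = \bot by apply/eqP; rewrite -lex0 mrho_le.
  by split=> //; exact: mrho_eq0 x00.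
have c0 y : collapse \bot (atom wfO y) = i0 y.
  by rewrite collapse_atom (hierarchy_id HY)// le0x.
have [i0_bij i0F i0R] := i0_iso.
split=> [x y|y|f x x0|R x x0].
- rewrite cum_sim0 inF0 => -[u _ <-] [v _ <-]; rewrite !c0.
  split=> [[_ [->]//]|/(bij_inj i0_bij) ->//].
- have [i0' _ i0'K] := i0_bij; exists (atom wfO (i0' y)); last by rewrite c0.
  exact/inFE.
- have [x00 _] := atoms _ _ x0.
  have [_ /(_ x00)[y -> ->] _] := cum_fun_spec x0.
  by rewrite c0 i0F; congr fint; apply/funext => i; rewrite c0.
- have [x00 [y xy]] := atoms _ _ x0; split=> [Rx|[x' [x'0 xx' Rx']]].
    exists x; split=> //; apply/cum_relE; left; split=> //.
    exists y => //; apply/i0R; move: Rx; congr rint; apply/funext => i.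
    by rewrite xy c0.
  move: Rx' => /cum_relE[[_ [y' x'y' Ry']]|[c [+ _ _]]]; last by rewrite ltx0.
  move: Ry' => /i0R; congr rint; apply/funext => i.
  by rewrite -xx' x'y' c0.
Qed.

(** By [collapse_succ], each clause turns into one of [ultrapower_proj] about the coordinates at
    [sec c y], where the hypothesis at [c] applies. *)
Lemma collapse_good_succ c b : is_succ c b -> b <= beta ->
  collapse_good c -> collapse_good b.
Proof.
move=> scb bbeta gc; have [cb _] := scb.
have [gsim gsurj gF gR] := gc.
have cs x : inF b x -> collapse b x =
  @uproj c b (fun y => collapse c (coord (sec c y) x)) by exact: collapse_succ.
have [Qsurj Qinj QF QR Qe] := uprojP scb bbeta.
have UF : ProperFilter (U c).
  by apply: ultra_proper; apply: (hierarchy_ultra HY); exact: lt_le_trans bbeta.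
have [_ ecbF ecbR] := hierarchy_emb wfO HY (ltW cb) bbeta.
split=> [x y xb yb|y|f x xb|R x xb].
- rewrite !cs // Qinj (cum_simS _ _ _ scb).
  set dl := Order.max _ _.
  have dlb : dl <= b by rewrite ge_max !rho_le.
  have E (j : cumF wfO A c) :
      cum_sim cum_ultra c (theta dl j x) (theta dl j y) <->
      collapse c (coord j x) = collapse c (coord j y).
    rewrite (theta_coord _ scb xb dlb) (theta_coord _ scb yb dlb).
    by rewrite gsim //; apply: inF_coord scb _.
  rewrite /cum_ultra /=; split=> [[_ _]|Uxy]; last split=> //.
    by apply: filterS => y0 /E.
  by apply: filterS Uxy => y0 /E.
- have [f <-] := Qsurj y.
  exists (cfun (fun j => sec c (f (collapse c (cval j))))); first exact/inFE.
  rewrite cs; last exact/inFE.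
  congr uproj; apply/funext => u.
  by rewrite coord_cfun !collapse_sec.
(* Either the tuple has rank [b] and the operation acts coordinatewise, or all arguments already lie
   in F_c and the value computed there is carried over by [e c b]. *)
- have := mrho_le xb; move=> /(succ_le scb)[xmax|xc'].
    have x0 : mrho x <> \bot by move=> x0; move: cb; rewrite -xmax x0 ltx0.
    have [zb _ /(_ x0)[c' [sc' zrho zapp]]] := cum_fun_spec xb.
    have {}sc' : is_succ c' b by rewrite -xmax.
    have cc' := succ_inj scb sc'; case: c' / cc' sc' zapp => _ zapp.
    rewrite cs // (_ : (fun i => collapse b (x i)) =
      fun i => uproj b (fun y => collapse c (coord (sec c y) (x i))));
      last first.
      by apply/funext => i; rewrite cs.
    rewrite -QF; congr uproj; apply/funext => y.
    rewrite {1}/coord zapp /= gF => [|i]; last first.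
      by apply: inF_theta (xb i) (mrho_ge x i) _; rewrite xmax.
    congr fint; apply/funext => i; congr collapse.
    by rewrite (theta_coord _ scb)// xmax.
  have xc := inF_mrho xb xc'; have [zc _ _] := cum_fun_spec xc.
  rewrite (cum_fun_le (ltW cb) xc) (collapse_le zc (ltW cb))// gF// ecbF.
  by congr fint; apply/funext => i; rewrite (collapse_le (xc i) (ltW cb)).
- have csx (z : 'I_(rarity R) -> cum wfO A) : (forall i, inF b (z i)) ->
      (fun i => collapse b (z i)) =
      fun i => uproj b (fun y => collapse c (coord (sec c y) (z i))).
    by move=> zb; apply/funext => i; rewrite cs.
  split=> [|[x' [x'b xx' Rx']]]; last first.
    rewrite (_ : (fun i => _) = fun i => collapse b (x' i)); last first.
      by apply/funext => i; rewrite xx'.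
    have := mrho_le x'b; move=> /(succ_le scb)[xmax|xc'].
      (* At rank [b] the relation holds at every index, so the set required to be large is the whole
         of [Y c]. *)
      rewrite csx // QR; apply: filterS filterT => y _ /=.
      apply: collapse_good_rel => // [i|]; first exact: inF_coord (x'b i).
      move: Rx' => /cum_relE[[x0 _]|[c' [_ + +]]].
        by move: cb; rewrite -xmax x0 ltx0.
      rewrite xmax => sc'; have cc' := succ_inj scb sc'.
      case: c' / cc' sc' => _ /(_ (sec c y)); congr cum_rel; apply/funext => i.
      by rewrite (theta_coord _ scb).
    have xc := inF_mrho x'b xc'.
    move: Rx' => /(cum_rel_le (ltW cb) xc)/(collapse_good_rel gc xc)/ecbR.
    congr rint; apply/funext => i.
    by rewrite (collapse_le (xc i) (ltW cb)).
  rewrite csx // QR => UR; have [y0 /= Ry0] := filter_ex UR.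
  (* Off the large set where [R] holds of the coordinates, [R] must still hold
     of the new representatives: reuse there those found at [y0]. *)
  have /choice[w wP] : forall j : cumF wfO A c,
      exists w : 'I_(rarity R) -> cumF wfO A c,
      cum_rel c (fun i => cval (w i)) /\
      (rint (fun i => collapse c (coord j (x i))) ->
       forall i, collapse c (cval (w i)) = collapse c (coord j (x i))).
    have wex (j : cumF wfO A c) : rint (fun i => collapse c (coord j (x i))) ->
        exists w : 'I_(rarity R) -> cumF wfO A c,
        cum_rel c (fun i => cval (w i)) /\
        forall i, collapse c (cval (w i)) = collapse c (coord j (x i)).
      move=> /gR[i|x' [x'c xx' Rx']]; first exact: inF_coord (xb i).
      have /choice[w wE] : forall i, exists w : cumF wfO A c, cval w = x' i.
        by move=> i; have [w _ <-] := x'c i; exists w.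
      exists w; split=> [|i]; last by rewrite wE xx'.
      by move: Rx'; congr cum_rel; apply/funext.
    move=> j; have [/wex[w [Rw wE]]|nR] :=
        pselect (rint (fun i => collapse c (coord j (x i)))).
      by exists w.
    by have [w [Rw _]] := wex _ Ry0; exists w.
  exists (fun i => cfun (fun j => w j i)).
  have x'b i : inF b (cfun (fun j => w j i)) by exact/inFE.
  split=> // [i|].
    rewrite !cs // Qinj; apply: filterS UR => y /= Ry.
    by rewrite coord_cfun; have [_ ->] := wP (sec c y).
  (* A nullary [R] has rank [\bot], so it is not evaluated at level [b]. *)
  have [n0|n0] := posnP (rarity R).
    have noarg (i : 'I_(rarity R)) : False by case: i => i; rewrite n0.
    have [Rw _] := wP (sec c y0).
    have Rc : mrho (fun i => cfun (fun j => w j i)) <= c.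
      by apply: bigmax_le => [|i]; [exact: le0x|case: (noarg i)].
    apply/(cum_rel_le (ltW cb) (inF_mrho x'b Rc)); move: Rw; congr cum_rel.
    by apply/funext => i; case: (noarg i).
  (* There is at least one argument, and a function on [cumF c] has rank [b]; hence the new tuple is
     evaluated coordinatewise. *)
  have bmax : mrho (fun i => cfun (fun j => w j i)) = b.
    apply: le_anti; rewrite mrho_le //=.
    rewrite -{1}(rho_cfun (w^~ (Ordinal n0)) scb).
    exact: (mrho_ge (fun i => cfun (w^~ i))).
  apply/cum_relE; right; exists c; rewrite bmax; split=> // j.
  have [Rw _] := wP j; move: Rw; congr cum_rel; apply/funext => i.
  by rewrite (theta_coord _ scb)// coord_cfun.
Qed.

(** Elements of F_l have rank below [l], so finitely many of them lie on a common level [a < l]; the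
    embedding [e a l] transports the clauses from there. *)
Lemma collapse_good_limit l : is_limit l -> l <= beta ->
  (forall a, a < l -> collapse_good a) -> collapse_good l.
Proof.
move=> liml lbeta IH; have [l0 _] := liml.
have rhol x : inF l x -> rho x < l.
  by rewrite (inFL _ _ liml) => -[a /= al /rho_le]; move=> /le_lt_trans; exact.
have level n (x : 'I_n -> cum wfO A) : (forall i, inF l (x i)) ->
    exists2 a, a < l & forall i, inF a (x i).
  move=> xl; exists (mrho x); last exact: inF_mrho xl (lexx _).
  by apply: bigmax_lt => // i _; exact: rhol.
have emb a : a < l -> is_embedding (e a l).
  by move=> al; exact: (hierarchy_emb wfO HY (ltW al)).
have cl a x : a < l -> inF a x -> collapse l x = e a l (collapse a x).
  by move=> al xa; rewrite (collapse_le xa (ltW al)).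
have inl a x : a < l -> inF a x -> inF l x by move=> al; exact: inF_le (ltW al).
split=> [x y xl yl|y|f x xl|R x xl].
- rewrite (cum_simL _ _ _ liml); split=> [[a al xy]|xy].
    have [xa ya _] := (cum_simE _ _ _ _).1 xy.
    have [gsim _ _ _] := IH a al.
    by rewrite !(cl a)//; congr e; exact/gsim.
  pose a := Order.max (rho x) (rho y).
  have al : a < l by rewrite gt_max !rhol.
  have xa : inF a x by apply: inF_rho xl _; rewrite le_max lexx.
  have ya : inF a y by apply: inF_rho yl _; rewrite le_max lexx orbT.
  have [gsim _ _ _] := IH a al; have [einj _ _] := emb a al.
  by exists a => //; apply/gsim => //; apply: einj; rewrite -!cl.
- have [a [z [al <-]]] := hierarchy_limit_surj HY y liml lbeta.
  have [_ /(_ z)[x xa <-] _ _] := IH a al.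
  by exists x; [exact: inl xa|rewrite (cl a)].
- have [a al xa] := level _ _ xl; have [_ _ gF _] := IH a al.
  have [_ eF _] := emb a al; have [za _ _] := cum_fun_spec xa.
  rewrite (cum_fun_le (ltW al) xa) (cl a)// gF// eF.
  by congr fint; apply/funext => i; rewrite (cl a).
- split=> [|[x' [x'l xx' Rx']]].
    have [a al xa] := level _ _ xl; have [_ _ _ gR] := IH a al.
    have [_ _ eR] := emb a al.
    rewrite (_ : (fun i => _) = fun i => e a l (collapse a (x i))); last first.
      by apply/funext => i; rewrite (cl a).
    rewrite -eR => /gR[//|x' [x'a xx' Rx']]; exists x'; split=> [i|i|].
    + exact: inl (x'a i).
    + by rewrite !(cl a)// xx'.
    + exact/(cum_rel_le (ltW al) x'a).
  have [a al xa] := level _ _ x'l; have [_ _ eR] := emb a al.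
  move: Rx' => /(cum_rel_le (ltW al) xa)/(collapse_good_rel (IH a al) xa)/eR.
  by congr rint; apply/funext => i; rewrite -xx' (cl a).
Qed.

Lemma collapse_goodP g : g <= beta -> collapse_good g.
Proof.
elim/(well_founded_ind wfO): g => g IH gbeta.
case: (bot_succ_limit g) => [->|[c scg]|limg].
- exact: collapse_good_bot.
- have [cg _] := scg; apply: (collapse_good_succ scg gbeta).
  by apply: IH => //; exact: le_trans (ltW cg) gbeta.
- apply: collapse_good_limit => // a ag.
  by apply: IH => //; exact: le_trans (ltW ag) gbeta.
Qed.

(** * The isomorphism at each level *)

Lemma FF_isomorphic g : g <= beta ->
  FF_welldef cum_ultra g /\ isomorphic (FF cum_ultra g) (Y g).
Proof.
move=> /collapse_goodP[gsim gsurj gF gR].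
apply: (quot_isomorphic _ (p := fun x => collapse g (cval x))).
- by move=> y; have [_ [x _ <-] <-] := gsurj y; exists x.
- by move=> x y; apply: gsim; exact: inF_cval.
- move=> f x; have xg i : inF g (cval (x i)) by exact: inF_cval.
  by have [[y _ yE] _ _] := cum_fun_spec xg; exists y.
- by move=> f x y ->; apply: gF => i; exact: inF_cval.
- move=> R x; rewrite gR => [|i]; last exact: inF_cval.
  split=> [[x' [x'g xx' Rx']]|[x' [xx' Rx']]].
    (* The representatives found live in [cum]; being in F_g, they lift along [cval] to [cumF g],
       the type on which the quotient is formed. *)
    have /choice[w wE] : forall i, exists w : cumF wfO A g, cval w = x' i.
      by move=> i; have [w _ <-] := x'g i; exists w.
    exists w; split=> [i|]; first by rewrite wE xx'.
    by move: Rx'; congr cum_rel; apply/funext.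
  by exists (fun i => cval (x' i)); split=> // i; exact: inF_cval.
Qed.

End Collapse.

Unset Implicit Arguments.

Theorem theorem5p16 (d : Order.disp_t) (O : bOrderType d)
    (wfO : well_founded (fun a b : O => a < b))
    (s : signature) (A : structure s) (beta : O)
    (Y : O -> structure s) (U : forall a : O, set_system (Y a))
    (e : forall a b : O, Y a -> Y b)
    (HY : ultrapower_hierarchy A beta U e) :
  exists U' : forall a : O, set_system (cumF wfO A a),
    (forall a : O, a < beta -> UltraFilter (U' a)) /\
    (forall g : O, g <= beta ->
       FF_welldef U' g /\ isomorphic (FF U' g) (Y g)).
Proof.
have [_ [i0 i0_iso] _ _ _] := HY.
exists (cum_ultra U e i0); split=> [a ab|g gb].
  exact: (cum_ultraP wfO HY).
exact: (FF_isomorphic wfO HY i0_iso).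
Qed.
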